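(* Let $S$ be a monoid. A right $S$-act $A$ is hollow if and only if $A$ is indecomposable and co-uniform.
   Context: A right $S$-act over a monoid $S$ is a non-empty set $A$ with a unital associative right action of $S$. A subact of $A$ is a non-empty subset closed under the action; it is proper if it is not equal to $A$. A subact $B$ of $A$ is superfluous in $A$, written $B\leq_s A$, if $B\cup C\neq A$ for every proper subact $C$ of $A$. An $S$-act $A$ is hollow if every proper subact of $A$ is superfluous in $A$. An epimorphism (surjective $S$-homomorphism) $f:D\to A$ is coessential if for every proper subact $C$ of $D$ the restriction $f|_C$ is not an epimorphism onto $A$. A subact $B$ of $A$ is coessential in $A$ if the canonical epimorphism $\pi:A\to A/B$ onto the Rees factor act (the quotient of $A$ identifying all elements of $B$ to one point and nothing else) is a coessential epimorphism. An $S$-act $A$ is co-uniform if every proper subact of $A$ is coessential in $A$. An $S$-act is indecomposable if it is not the disjoint union of two (non-empty) subacts. *)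

(* Defs.v *)
From HB Require Import structures.
From mathcomp Require Import all_boot.
From mathcomp Require Import boolp classical_sets.

Set Implicit Arguments.
Unset Strict Implicit.
Unset Printing Implicit Defensive.

Local Open Scope classical_set_scope.
Local Open Scope quotient_scope.

(* As for monoidType, the carrier of an act is a choiceType; classically this
   is no restriction (see gen_choiceMixin in boolp). *)
HB.mixin Record isRightAct (S : monoidType) (A : Type) := {
  actr : A -> S -> A;
  actr1 : forall a, actr a 1%g = a;
  actrM : forall a s t, actr a (s * t)%g = actr (actr a s) t;
  act_nonempty : [set: A] !=set0
}.

#[short(type="rightActType")]
HB.structure Definition RightAct (S : monoidType) :=
  {A of isRightAct S A & Choice A}.

Record subact (S : monoidType) (A : rightActType S) := Subact {
  subact_set :> set A;
  subact_neq0 : subact_set !=set0;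
  subact_closed : forall a s, subact_set a -> subact_set (actr a s)
}.

Definition proper_subact (S : monoidType) (A : rightActType S)
  (B : subact A) : Prop := (B : set A) <> [set: A].

Section SubactAct.
Variables (S : monoidType) (A : rightActType S) (B : subact A).

Record subact_type := SubactElt {
  subact_val : A;
  subact_valP : subact_val \in (B : set A)
}.

HB.instance Definition _ := [isSub for subact_val].
HB.instance Definition _ := [Choice of subact_type by <:].

Definition sub_actr (x : subact_type) (s : S) : subact_type :=
  SubactElt (mem_set (subact_closed s (set_mem (subact_valP x)))).

Lemma sub_actr1 (x : subact_type) : sub_actr x 1%g = x.
Proof. by apply: val_inj; rewrite /= actr1. Qed.

Lemma sub_actrM (x : subact_type) (s t : S) :
  sub_actr x (s * t)%g = sub_actr (sub_actr x s) t.
Proof. by apply: val_inj; rewrite /= actrM. Qed.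

Lemma sub_act_nonempty : [set: subact_type] !=set0.
Proof. by have [a Ba] := subact_neq0 B; exists (SubactElt (mem_set Ba)). Qed.

HB.instance Definition _ :=
  isRightAct.Build S subact_type sub_actr1 sub_actrM sub_act_nonempty.

End SubactAct.

Definition act_hom (S : monoidType) (D A : rightActType S) (f : D -> A) : Prop :=
  forall d s, f (actr d s) = actr (f d) s.

Definition act_epi (S : monoidType) (D A : rightActType S) (f : D -> A) : Prop :=
  act_hom f /\ range f = [set: A].

Definition act_restr (S : monoidType) (D A : rightActType S) (f : D -> A)
  (C : subact D) : subact_type C -> A := fun x => f (subact_val x).

Definition superfluous (S : monoidType) (A : rightActType S)
  (B : subact A) : Prop :=
  forall C : subact A, proper_subact C -> B `|` C <> [set: A].

Definition hollow (S : monoidType) (A : rightActType S) : Prop :=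
  forall B : subact A, proper_subact B -> superfluous B.

Definition coessential_epi (S : monoidType) (D A : rightActType S)
  (f : D -> A) : Prop :=
  act_epi f /\
  forall C : subact D, proper_subact C -> ~ act_epi (act_restr f (C := C)).

Section ReesFactor.
Variables (S : monoidType) (A : rightActType S) (B : subact A).

Definition rees_rel : rel A := fun a b =>
  `[< a = b \/ (subact_set B a /\ subact_set B b) >].

Lemma rees_rel_refl : reflexive rees_rel.
Proof. by move=> a; apply/asboolP; left. Qed.

Lemma rees_rel_sym : symmetric rees_rel.
Proof.
by move=> a b; apply/asboolP/asboolP => -[->|[Ba Bb]]; by [left|right].
Qed.

Lemma rees_rel_trans : transitive rees_rel.
Proof.
move=> b a c /asboolP[->//|[Ba Bb]] /asboolP[<-|[_ Bc]];
  by apply/asboolP; right.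
Qed.

Canonical rees_equiv :=
  EquivRel rees_rel rees_rel_refl rees_rel_sym rees_rel_trans.

Definition rees_factor := {eq_quot rees_rel}.

HB.instance Definition _ := Choice.on rees_factor.
HB.instance Definition _ := EqQuotient.on rees_factor.

Definition rees_proj (a : A) : rees_factor := \pi_rees_factor a.

Lemma rees_projK (x : rees_factor) : rees_proj (repr x) = x.
Proof. exact: reprK. Qed.

(* Well defined, i.e. independent of the representative: rees_projM. *)
Definition rees_actr (x : rees_factor) (s : S) : rees_factor :=
  rees_proj (actr (repr x) s).

Lemma rees_projM (a : A) (s : S) :
  rees_actr (rees_proj a) s = rees_proj (actr a s).
Proof.
apply/eqP; rewrite /rees_actr /rees_proj eqmodE.
have : rees_rel (repr (rees_proj a)) a.
  by rewrite -[rees_rel _ _](eqmodE rees_equiv); apply/eqP; apply: rees_projK.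
move=> /asboolP[->|[Bb Ba]]; first exact: rees_rel_refl.
by apply/asboolP; right; split; apply: subact_closed.
Qed.

Lemma rees_actr1 (x : rees_factor) : rees_actr x 1%g = x.
Proof. by rewrite -[x]rees_projK rees_projM actr1. Qed.

Lemma rees_actrM (x : rees_factor) (s t : S) :
  rees_actr x (s * t)%g = rees_actr (rees_actr x s) t.
Proof. by rewrite -[x]rees_projK !rees_projM actrM. Qed.

Lemma rees_nonempty : [set: rees_factor] !=set0.
Proof. by have [a _] := @act_nonempty S A; exists (rees_proj a). Qed.

HB.instance Definition _ :=
  isRightAct.Build S rees_factor rees_actr1 rees_actrM rees_nonempty.

End ReesFactor.

Definition coessential (S : monoidType) (A : rightActType S)
  (B : subact A) : Prop := coessential_epi (@rees_proj S A B).

Definition co_uniform (S : monoidType) (A : rightActType S) : Prop :=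
  forall B : subact A, proper_subact B -> coessential B.

Definition indecomposable (S : monoidType) (A : rightActType S) : Prop :=
  ~ exists B C : subact A, B `&` C = set0 /\ B `|` C = [set: A].

(* Main.v *)
Require Import Defs.
From HB Require Import structures.
From mathcomp Require Import all_boot.
From mathcomp Require Import boolp classical_sets.

(* The Rees projection [A -> A/B] restricted to a subact [C] is onto exactly
   when [C] meets [B] (so that the collapsed point is reached) and [B], [C]
   cover [A].  Hence a non-superfluous proper [B] with witness [C] either
   decomposes [A] (when [B] and [C] are disjoint) or is not coessential. *)

Local Open Scope classical_set_scope.

Lemma rees_projP {S : monoidType} {A : rightActType S} {B : subact A}
    {a b : A} :
  rees_proj B a = rees_proj B b <-> a = b \/ (subact_set B a /\ subact_set B b).
Proof.
by split=> [/eqP|ab]; [|apply/eqP]; rewrite /rees_proj eqmodE;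
  [move/asboolP | apply/asboolP].
Qed.

Lemma rees_proj_hom {S : monoidType} {A : rightActType S} (B : subact A) :
  act_hom (@rees_proj S A B).
Proof. by move=> a s; rewrite -[LHS]rees_projM. Qed.

Lemma rees_proj_epi {S : monoidType} {A : rightActType S} (B : subact A) :
  act_epi (@rees_proj S A B).
Proof.
split; first exact: rees_proj_hom.
by apply/seteqP; split=> // x _; exists (repr x) => //; apply: rees_projK.
Qed.

Lemma rees_restr_epiP {S : monoidType} {A : rightActType S} {B C : subact A} :
  act_epi (act_restr (@rees_proj S A B) (C := C)) <->
  B `&` C !=set0 /\ B `|` C = [set: A].
Proof.
split=> [[_ surj]|[[b [Bb Cb]] BC]].
(* Surjectivity at the class of [a] gives a preimage in [C]; equality of Rees classes leaves these
   two cases. *)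
- have lift a : exists2 c, subact_set C c &
      c = a \/ (subact_set B c /\ subact_set B a).
    have : range (act_restr (@rees_proj S A B) (C := C)) (rees_proj B a).
      by rewrite surj.
    move=> [c _ /rees_projP ca]; exists (subact_val c) => //.
    exact: set_mem (subact_valP c).
  split.
    (* A lift of a point of [B] lies in [B] in either case, so [B] and [C] meet. *)
    have [b Bb] := subact_neq0 B; have [c Cc cb] := lift b.
    by exists c; split=> //; case: cb => [->|[]].
  apply/seteqP; split=> // a _.
  by have [c Cc [<-|[_ Ba]]] := lift a; [right|left].
- split=> [c s|]; first exact: rees_proj_hom.
  apply/seteqP; split=> // x _.
  have : (B `|` C) (repr x) by rewrite BC.
  move=> [Bx|Cx].
    (* Here [x] is the collapsed point, reached from [C] through the common element [b]. *)
    exists (SubactElt (mem_set Cb)) => //.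
    by rewrite -[x]rees_projK; apply/rees_projP; right.
  exists (SubactElt (mem_set Cx)) => //; exact: rees_projK.
Qed.

Theorem theorem3p4 (S : monoidType) (A : rightActType S) :
  hollow A <-> (indecomposable A /\ co_uniform A).
Proof.
split=> [hA|[indA cuA] B Bproper C Cproper BC].
- split=> [[B [C [BC0 BCT]]]|B Bproper].
    (* Being disjoint from a non-empty subact makes each part proper, so hollowness applies. *)
    have Bproper : proper_subact B.
      move=> BT; have [c Cc] := subact_neq0 C.
      by have : (B `&` C) c; [rewrite BT | rewrite BC0].
    have Cproper : proper_subact C.
      move=> CT; have [b Bb] := subact_neq0 B.
      by have : (B `&` C) b; [rewrite CT | rewrite BC0].
    exact: hA Bproper C Cproper BCT.
  split=> [|C Cproper /rees_restr_epiP[_]]; first exact: rees_proj_epi.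
  exact: hA.
- have [BC0|/set0P meetBC] := eqVneq (B `&` C) set0.
    by apply: indA; exists B, C.
  (* As [B] and [C] meet and cover [A], the projection stays onto on the proper subact [C]. *)
  by case: (cuA B Bproper) => _ /(_ C Cproper); apply; apply/rees_restr_epiP.
Qed.
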